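(* Let $p\in(0,1)$ and let $(k(n))_n$ be any sequence of integers with $0\le k(n)\le n$ and $k(n)/n\to p$ as $n\to\infty$. Then the renormalized curves $\varphi_{n,k(n)}$ associated with the basic blocks $B_{n,k(n)}$ converge to $\mathcal{M}_p$ in $L^\infty([0,1])$: $$\lim_{n\to\infty}\|\varphi_{n,k(n)}-\mathcal{M}_p\|_\infty=0 .$$ Moreover, the denominator $$F_{n,k(n)}\Bigl(\tbinom{n-1}{k(n)-1}\Bigr)-\frac{\binom{n-1}{k(n)-1}}{\binom{n}{k(n)}}\,F_{n,k(n)}\Bigl(\tbinom{n}{k(n)}\Bigr)$$ in the definition of $\varphi_{n,k(n)}$ is of order $\frac1n\binom{n}{k(n)}$.
   Context: Basic blocks: words $B_{n,k}$ ($n\ge1$, $0\le k\le n$) on the alphabet $\{a,b\}$ are defined inductively by $B_{n,0}:=a$, $B_{n,n}:=b$ for $n\ge1$, and $B_{n,k}:=B_{n-1,k-1}B_{n-1,k}$ (concatenation) for $0<k<n$. The word $B_{n,k}$ has length $\binom nk$; $B_{n,k}(\ell)$ denotes its $\ell$-th letter. The function $F_{n,k}:[0,\binom nk]\to\mathbb{R}$ is defined by $F_{n,k}(0)=0$; for integers $1\le\ell\le\binom nk$, $F_{n,k}(\ell)=F_{n,k}(\ell-1)+1$ if $B_{n,k}(\ell)=a$ and $F_{n,k}(\ell)=F_{n,k}(\ell-1)-1$ if $B_{n,k}(\ell)=b$; and $F_{n,k}$ is linearly interpolated between consecutive integers. The renormalized curve is $\varphi_{n,k}:[0,1]\to\mathbb{R}$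 (for $0<k<n$), $$\varphi_{n,k}(t):=\frac{F_{n,k}\bigl(t\binom nk\bigr)-t\,F_{n,k}\bigl(\binom nk\bigr)}{F_{n,k}\bigl(\binom{n-1}{k-1}\bigr)-\frac{\binom{n-1}{k-1}}{\binom nk}F_{n,k}\bigl(\binom nk\bigr)} .$$ For $0<p<1$, let $\alpha_p^L(x,y):=(px,\,py+x)$ and $\alpha_p^R(x,y):=\bigl((1-p)x+p,\,(1-p)y-x+1\bigr)$, affine maps of $[0,1]\times\mathbb{R}$ to itself. There is a unique nonempty compact set $E_p\subset[0,1]\times\mathbb{R}$ with $E_p=\alpha_p^L(E_p)\cup\alpha_p^R(E_p)$, and $E_p$ is the graph of a continuous function $\mathcal{M}_p:[0,1]\to\mathbb{R}$; this defines $\mathcal{M}_p$. ''$u_n$ is of order $v_n$'' means that there are constants $0<c\le C<\infty$ with $c\,v_n\le |u_n|\le C\,v_n$ for all sufficiently large $n$. *)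

(* Defs.v *)
From HB Require Import structures.
From mathcomp Require Import all_boot all_order all_algebra.
From mathcomp Require Import all_classical all_reals all_analysis.

Set Implicit Arguments.
Unset Strict Implicit.
Unset Printing Implicit Defensive.

Import Order.TTheory GRing.Theory Num.Theory.
Import numFieldNormedType.Exports.

Local Open Scope classical_set_scope.
Local Open Scope ring_scope.

Variant letter := letter_a | letter_b.

(* Outside the range n >= 1, k <= n the value is the empty word. *)
Fixpoint basic_block (n k : nat) : seq letter :=
  match n with
  | 0 => [::]
  | n'.+1 =>
      if k == 0%N then [:: letter_a]
      else if k == n'.+1 then [:: letter_b]
      else basic_block n' k.-1 ++ basic_block n' k
  end.

Lemma size_basic_block (n k : nat) :
  (0 < n)%N -> (k <= n)%N -> size (basic_block n k) = 'C(n, k).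
Proof.
case: n => // n _; elim: n k => [|n IHn] [|k] //.
  by rewrite ltnS leqn0 => /eqP->.
rewrite [basic_block _ _]/=; case: eqP => [->|/eqP nk le_kn].
  by rewrite binn.
have lt_kn : (k < n.+1)%N by rewrite ltn_neqAle -(eqSS k n.+1) nk.
rewrite size_cat binS addnC -(IHn k.+1 lt_kn) -(IHn k (ltnW lt_kn)).
by [].
Qed.

(* Words are read from index 0 here: the letter number l.+1 is [nth _ _ l]. *)
Fixpoint height (R : realType) (n k l : nat) : R :=
  match l with
  | 0 => 0
  | l'.+1 => height R n k l' +
      match nth letter_a (basic_block n k) l' with
      | letter_a => 1
      | letter_b => -1
      end
  end.

(* The function F_{n,k}, meaningful on the interval [0, 'C(n, k)]; at the
   right endpoint the slope, which is then arbitrary, has coefficient 0. *)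
Definition curve (R : realType) (n k : nat) (x : R) : R :=
  let l := Num.truncn x in
  height R n k l + (x - l%:R) * (height R n k l.+1 - height R n k l).

Definition renorm (R : realType) (n k : nat) : R :=
  curve n k ('C(n.-1, k.-1))%:R
  - ('C(n.-1, k.-1))%:R / ('C(n, k))%:R * curve n k ('C(n, k))%:R.

Definition renorm_curve (R : realType) (n k : nat) (t : R) : R :=
  (curve n k (t * ('C(n, k))%:R) - t * curve n k ('C(n, k))%:R)
  / renorm R n k.

Definition alphaL (R : realType) (p : R) (z : R * R) : R * R :=
  (p * z.1, p * z.2 + z.1).

Definition alphaR (R : realType) (p : R) (z : R * R) : R * R :=
  ((1 - p) * z.1 + p, (1 - p) * z.2 - z.1 + 1).

Definition is_attractor (R : realType) (p : R) (E : set (R * R)) : Prop :=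
  [/\ E !=set0, compact E, E `<=` `[0, 1] `*` setT &
      E = alphaL p @` E `|` alphaR p @` E].

(* For 0 < p < 1 there is exactly one such set; [xget] selects it. *)
Definition attractor (R : realType) (p : R) : set (R * R) :=
  xget set0 [set E | is_attractor p E].

(* For 0 < p < 1 the set [attractor p] is the graph over [0, 1] of a
   continuous function; it is this function (default value 0 elsewhere). *)
Definition blancmange (R : realType) (p t : R) : R :=
  xget 0 [set y | attractor p (t, y)].

Definition Linfty_norm01 (R : realType) (f : R -> R) : \bar R :=
  Lnorm (mrestr (@lebesgue_measure R) (measurable_itv `[0, 1])) +oo%E
    (EFin \o f).

Definition of_order (R : realType) (u v : nat -> R) : Prop :=
  exists c C : R, [/\ 0 < c, c <= C &
    \forall n \near \oo, c * v n <= `|u n| /\ `|u n| <= C * v n].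

(* Main.v *)
Require Import Defs.
From HB Require Import structures.
From mathcomp Require Import all_boot all_order all_algebra.
From mathcomp Require Import all_classical all_reals all_analysis.
From mathcomp Require Import ess_sup_inf.
From mathcomp Require Import ring lra.

Set Implicit Arguments.
Unset Strict Implicit.
Unset Printing Implicit Defensive.

Import Order.TTheory GRing.Theory Num.Theory.
Import numFieldNormedType.Exports.

Local Open Scope classical_set_scope.
Local Open Scope ring_scope.

(** A block is made of two halves, [B_{n,k} = B_{n-1,k-1} B_{n-1,k}], in
    general of different lengths: the cut is at abscissa [q = k/n], since
    ['C(n-1, k-1) = q 'C(n, k)]. Subtracting the chord from both halves of the
    curve gives the exact self-similarity ([centered_left], [centered_right])

      G_{n,k}(q s)           = G_{n-1,k-1}(s) + s D,
      G_{n,k}(q + (1 - q) s) = G_{n-1,k}(s) + (1 - s) D,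

    where [G] is the numerator of the renormalized curve and [D] its
    denominator. The letter counts of a block being explicit, so is [D]: it
    equals [2 k (n - k) 'C(n, k) / (n^2 (n - 1))] ([renormE]), whence its
    order. After division by [D], the two lines become those of the two affine
    maps that define the limit curve, except that [p] is replaced by [q] in
    the abscissa and by a ratio of two denominators in the ordinate; both tend
    to [p] (to [1 - p] on the right half).

    The limit curve is built as the fixed point of a contraction on functions
    that vanish outside [0, 1]. Its graph is an attractor, and any attractor
    is contained in it and projects onto [0, 1], so it is the attractor
    ([blancmangeE]).

    For the convergence, the curve is compared with the graph of the limit:
    [near_graph n k d] says that every point of the renormalized curve is
    [d]-close to that graph, horizontal displacements being allowed. These
    absorb the discrepancy between the cut points [q] and [p]. As the two
    affine maps contract, a distance that is eventually at most [d] for all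
    sequences with [k/n --> p] is eventually at most [mu d], for a fixed
    factor [mu] below [1] ([eventually_near_step]): apply the assumption to
    the two sequences of halves. Iteration makes the distance arbitrarily
    small, and the uniform continuity of the limit curve turns it into a
    uniform distance. The iteration starts because the renormalized curves are
    uniformly bounded when [k/n] stays away from [0] and [1]
    ([renorm_curve_le]), which follows from a weight that dominates [G] and is
    stable under the recursion ([centered_le]). *)

(** * Heights along a basic block *)

Definition letter_step (R : realType) (x : letter) : R :=
  match x with letter_a => 1 | letter_b => -1 end.

Lemma height_sum (R : realType) n k l :
  height R n k l =
  \sum_(i < l) letter_step R (nth letter_a (basic_block n k) i).
Proof.
elim: l => [|l IHl]; first by rewrite big_ord0.
by rewrite big_ord_recr -IHl.
Qed.

Lemma basic_block_cat n k : (k <= n)%N ->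
  basic_block n.+2 k.+1 = basic_block n.+1 k ++ basic_block n.+1 k.+1.
Proof.
move=> le_kn; have neq : (k.+1 == n.+2) = false.
  by rewrite eqSS ltn_eqF // ltnS.
rewrite -[LHS]/(if k.+1 == n.+2 then [:: letter_b]
  else basic_block n.+1 k ++ basic_block n.+1 k.+1).
by rewrite neq.
Qed.

Lemma height_left (R : realType) n k l : (k <= n)%N -> (l <= 'C(n.+1, k))%N ->
  height R n.+2 k.+1 l = height R n.+1 k l.
Proof.
move=> le_kn le_l; rewrite !height_sum basic_block_cat //.
apply: eq_bigr => i _; rewrite nth_cat size_basic_block ?(leqW le_kn) //.
by rewrite (leq_trans (ltn_ord i) le_l).
Qed.

Lemma height_right (R : realType) n k l : (k <= n)%N ->
  height R n.+2 k.+1 ('C(n.+1, k) + l) =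
  height R n.+1 k 'C(n.+1, k) + height R n.+1 k.+1 l.
Proof.
move=> le_kn; rewrite -(height_left R le_kn (leqnn _)) !height_sum.
rewrite big_split_ord; congr (_ + _).
apply: eq_bigr => i _; rewrite basic_block_cat // nth_cat.
rewrite size_basic_block ?(leqW le_kn) //.
by rewrite [nat_of_ord _]/= ltnNge leq_addr addKn.
Qed.

Lemma curve_nat (R : realType) n k m :
  curve n k (m%:R : R) = height R n k m.
Proof. by rewrite /curve natrK subrr mul0r addr0. Qed.

Lemma curve_left (R : realType) n k (x : R) : (k <= n)%N ->
  0 <= x -> x <= ('C(n.+1, k))%:R ->
  curve n.+2 k.+1 x = curve n.+1 k x.
Proof.
move=> le_kn x_ge0; rewrite le_eqVlt => /predU1P[->|lt_x].
  by rewrite !curve_nat height_left.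
have lt_l : (Num.truncn x < 'C(n.+1, k))%N by rewrite truncn_lt_nat.
by rewrite /curve !height_left // ltnW.
Qed.

Lemma curve_right (R : realType) n k (x : R) : (k <= n)%N -> 0 <= x ->
  curve n.+2 k.+1 (('C(n.+1, k))%:R + x) =
  curve n.+1 k ('C(n.+1, k))%:R + curve n.+1 k.+1 x.
Proof.
move=> le_kn x_ge0.
have trE : Num.truncn (('C(n.+1, k))%:R + x) = ('C(n.+1, k) + Num.truncn x)%N.
  by rewrite truncnD ?natrK ?natr_nat // qualifE.
rewrite /curve trE -addnS !height_right // natrD natrK subrr mul0r addr0.
ring.
Qed.

Lemma binS_left (R : realType) n k :
  ('C(n.+1, k))%:R = ('C(n.+2, k.+1))%:R * k.+1%:R / n.+2%:R :> R.
Proof.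
apply: (canRL (mulfK _)); first by rewrite pnatr_eq0.
by rewrite -!natrM; congr _%:R; rewrite mulnC mul_bin_diag mulnC.
Qed.

Lemma binS_right (R : realType) n k : (k <= n)%N ->
  ('C(n.+1, k.+1))%:R =
  ('C(n.+2, k.+1))%:R * (n.+1%:R - k%:R) / n.+2%:R :> R.
Proof.
move=> le_kn; have -> : ('C(n.+1, k.+1))%:R =
    ('C(n.+2, k.+1))%:R - ('C(n.+1, k))%:R :> R.
  by rewrite (binS n.+1) natrD addrK.
rewrite (binS_left R n k).
have n2 : n%:R + 2 != 0 :> R by rewrite -natrD pnatr_eq0 addn2.
by field.
Qed.

(** The block has ['C(n - 1, k)] letters a and ['C(n - 1, k - 1)] letters b,
    in proportions [1 - k / n] and [k / n]; this form of the difference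
    extends to the blocks reduced to one letter. *)
Lemma height_total (R : realType) n k : (0 < n)%N -> (k <= n)%N ->
  height R n k 'C(n, k) = ('C(n, k))%:R * (n%:R - 2 * k%:R) / n%:R.
Proof.
case: n => // n _; elim: n k => [|n IHn] [|k] //.
- by move=> _; rewrite /= add0r bin0; field.
- by rewrite ltnS leqn0 => /eqP->; rewrite binn /= add0r; field.
- by move=> _; rewrite /= add0r bin0; field; rewrite -natrD pnatr_eq0.
rewrite ltnS leq_eqVlt => /predU1P[->|le_kn].
  by rewrite binn /= eqxx add0r; field; rewrite -natrD pnatr_eq0.
rewrite [in LHS]binS addnC height_right ?(ltnW le_kn) // !IHn ?(ltnW le_kn) //.
rewrite (binS_left R n k) (@binS_right R n k _) ?(ltnW le_kn) //.
by field; rewrite -natrD nat1r !pnatr_eq0.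
Qed.

(** * The centered curve and its self-similarity *)

(** The numerator of [renorm_curve]: the deviation of the curve from its
    chord. *)
Definition centered (R : realType) (n k : nat) (t : R) : R :=
  curve n k (t * ('C(n, k))%:R) - t * curve n k ('C(n, k))%:R.

Lemma renormE (R : realType) n k : (k <= n)%N ->
  renorm R n.+2 k.+1 = 2 * k.+1%:R * (n.+1%:R - k%:R) /
    (n.+2%:R ^+ 2 * n.+1%:R) * ('C(n.+2, k.+1))%:R.
Proof.
move=> le_kn; rewrite /renorm !curve_nat -[n.+2.-1]/n.+1 -[k.+1.-1]/k.
rewrite height_left // !height_total ?ltnS ?(leqW le_kn) // (binS_left R n k).
have C0 : ('C(n.+2, k.+1))%:R != 0 :> R.
  by rewrite pnatr_eq0 -lt0n bin_gt0 ltnS leqW.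
by field; rewrite C0 -natrD nat1r !pnatr_eq0.
Qed.

(** The denominator is the deviation from the chord at the cut point, hence
    the coefficient of the affine terms in the self-similarity relations
    below. *)
Lemma renorm_split (R : realType) n k : (k <= n)%N ->
  renorm R n.+2 k.+1 = curve n.+1 k ('C(n.+1, k))%:R
    - k.+1%:R / n.+2%:R * curve n.+2 k.+1 ('C(n.+2, k.+1))%:R.
Proof.
move=> le_kn; rewrite /renorm -[n.+2.-1]/n.+1 -[k.+1.-1]/k curve_left //.
have C0 : ('C(n.+2, k.+1))%:R != 0 :> R.
  by rewrite pnatr_eq0 -lt0n bin_gt0 ltnS leqW.
congr (_ - _ * _); rewrite (binS_left R n k).
by field; rewrite -natrD pnatr_eq0 C0.
Qed.

Lemma centered_left (R : realType) n k (s : R) : (k <= n)%N -> 0 <= s <= 1 ->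
  centered n.+2 k.+1 (s * (k.+1%:R / n.+2%:R)) =
  centered n.+1 k s + s * renorm R n.+2 k.+1.
Proof.
move=> le_kn /andP[s_ge0 s_le1].
have xE : s * (k.+1%:R / n.+2%:R) * ('C(n.+2, k.+1))%:R =
          s * ('C(n.+1, k))%:R.
  by rewrite (binS_left R n k); field; rewrite -natrD pnatr_eq0.
rewrite /centered xE curve_left ?mulr_ge0 ?ler_piMl // renorm_split //; ring.
Qed.

Lemma centered_right (R : realType) n k (s : R) : (k <= n)%N -> 0 <= s ->
  centered n.+2 k.+1 (k.+1%:R / n.+2%:R + s * (1 - k.+1%:R / n.+2%:R)) =
  centered n.+1 k.+1 s + (1 - s) * renorm R n.+2 k.+1.
Proof.
move=> le_kn s_ge0.
have xE : (k.+1%:R / n.+2%:R + s * (1 - k.+1%:R / n.+2%:R)) *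
          ('C(n.+2, k.+1))%:R = ('C(n.+1, k))%:R + s * ('C(n.+1, k.+1))%:R.
  rewrite (binS_left R n k) (@binS_right R n k le_kn); field.
  by rewrite -natrD pnatr_eq0.
rewrite /centered xE curve_right ?mulr_ge0 // renorm_split //.
have -> : curve n.+2 k.+1 (('C(n.+2, k.+1))%:R : R) =
          curve n.+1 k ('C(n.+1, k))%:R + curve n.+1 k.+1 ('C(n.+1, k.+1))%:R.
  by rewrite (binS n.+1) natrD addrC curve_right.
ring.
Qed.

Lemma centered_letter (R : realType) n k (t : R) :
  'C(n, k) = 1%N -> 0 <= t <= 1 -> centered n k t = 0.
Proof.
move=> C1 /andP[t_ge0]; rewrite /centered C1 mulr1 le_eqVlt.
case/predU1P=> [->|t_lt1]; first by rewrite mul1r subrr.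
rewrite curve_nat /curve (_ : Num.truncn t = 0)%N ?add0r ?subr0 ?subrr //.
by apply: truncn_def; rewrite t_ge0.
Qed.

Lemma unit_split (R : realType) (q t : R) : 0 < q < 1 -> 0 <= t <= 1 ->
  (exists2 s, 0 <= s <= 1 & t = s * q) \/
  (exists2 s, 0 <= s <= 1 & t = q + s * (1 - q)).
Proof.
move=> /andP[q_gt0 q_lt1] /andP[t_ge0 t_le1].
have q1_gt0 : 0 < 1 - q by rewrite subr_gt0.
have [le_tq|/ltW le_qt] := leP t q; [left | right].
  exists (t / q); last by rewrite divfK ?gt_eqF.
  by rewrite divr_ge0 ?(ltW q_gt0) // ler_pdivrMr ?mul1r.
exists ((t - q) / (1 - q)); last by rewrite divfK ?gt_eqF // addrC subrK.
by rewrite divr_ge0 ?(ltW q1_gt0) ?subr_ge0 //= ler_pdivrMr // mul1r lerD2r.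
Qed.

Lemma frac_itv (R : realType) n k : (k <= n)%N ->
  0 < (k.+1%:R / n.+2%:R : R) < 1.
Proof.
move=> le_kn; rewrite divr_gt0 ?ltr0Sn //.
by rewrite ltr_pdivrMr ?ltr0Sn // mul1r ltr_nat.
Qed.

(** This is [weight_left] at [k = x + 2] and [n = x + y + 3], divided by [2
    'C(n, k)]. After clearing denominators the difference of the two sides is
    a polynomial with nonnegative coefficients. *)
Lemma weight_ineq (R : realType) (x y : R) : 0 <= x -> 0 <= y ->
  (x + 2) / (x + y + 3) * ((x + y + 2) / ((x + 1) * (y + 1)))
  + (x + 2) * (y + 1) / ((x + y + 3) ^+ 2 * (x + y + 2))
  <= (x + y + 3) / ((x + 2) * (y + 1)).
Proof.
move=> x_ge0 y_ge0; rewrite -subr_ge0.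
have -> : (x + y + 3) / ((x + 2) * (y + 1)) -
  ((x + 2) / (x + y + 3) * ((x + y + 2) / ((x + 1) * (y + 1)))
   + (x + 2) * (y + 1) / ((x + y + 3) ^+ 2 * (x + y + 2))) =
  ((x + 1) * (x ^+ 3 + 2 * x ^+ 2 * y + 3 * x * y ^+ 2 + y ^+ 3 + 5 * x ^+ 2
     + 8 * x * y + 6 * y ^+ 2 + 7 * x + 7 * y + 2)
   + (x + y + 3) * (x + y + 2) * x)
  / ((x + y + 3) ^+ 2 * (x + y + 2) * (x + 2) * (x + 1)).
  by field; rewrite !gt_eqF //; lra.
have ? : 0 <= x * y by exact: mulr_ge0.
by rewrite divr_ge0 // ?addr_ge0 ?mulr_ge0 ?exprn_ge0 ?addr_ge0 ?mulr_ge0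
           ?exprn_ge0.
Qed.

(** A multiple of ['C(n, k) / n] would not do as a bound for [centered]: near
    both ends of a row one half is almost the whole block, which leaves no
    room for the added [renorm]. Letting the weight grow there makes it stable
    under the recursion ([weight_left], [weight_right]), and it keeps the
    order of ['C(n, k) / n] as long as [k / n] stays away from [0] and [1].
    The value is [0], from the inverse of [0], on the blocks reduced to one
    letter, whose centered curve is [0]. *)
Definition weight (R : realType) (n k : nat) : R :=
  2 * ('C(n, k))%:R * (n%:R / (k%:R * (n%:R - k%:R))).

Lemma weight_ge0 (R : realType) n k : (k <= n)%N -> 0 <= weight R n k.
Proof.
by move=> le_kn; rewrite !mulr_ge0 // invr_ge0 mulr_ge0 // subr_ge0 ler_nat.
Qed.

Lemma renorm_ge0 (R : realType) n k : (k <= n)%N -> 0 <= renorm R n.+2 k.+1.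
Proof.
move=> le_kn; rewrite renormE // !mulr_ge0 // ?invr_ge0 ?mulr_ge0 ?exprn_ge0 //.
by rewrite subr_ge0 ler_nat leqW.
Qed.

(** [renorm_le_weight] at [k = x + 1] and [n = x + y + 2], divided by [2 'C(n,
    k)]. *)
Lemma weight_ineq0 (R : realType) (x y : R) : 0 <= x -> 0 <= y ->
  (x + 1) * (y + 1) / ((x + y + 2) ^+ 2 * (x + y + 1)) <=
  (x + y + 2) / ((x + 1) * (y + 1)).
Proof.
move=> x_ge0 y_ge0; have ? : 0 <= x * y by exact: mulr_ge0.
have lex : (x + 1) * (y + 1) <= (x + y + 2) * (x + y + 1) by nra.
have ley : (x + 1) * (y + 1) <= (x + y + 2) ^+ 2 by nra.
rewrite ler_pdivrMr; last by rewrite mulr_gt0 ?exprn_gt0; lra.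
rewrite mulrAC ler_pdivlMr; last by rewrite mulr_gt0; lra.
have -> : (x + y + 2) * ((x + y + 2) ^+ 2 * (x + y + 1)) =
  (x + y + 2) * (x + y + 1) * (x + y + 2) ^+ 2 by ring.
by rewrite ler_pM // mulr_ge0; lra.
Qed.

Lemma renorm_le_weight (R : realType) n k : (k <= n)%N ->
  renorm R n.+2 k.+1 <= weight R n.+2 k.+1.
Proof.
move=> le_kn; rewrite renormE // /weight.
have [m ->] : exists m, n = (k + m)%N by exists (n - k)%N; rewrite subnKC.
set c := ('C(_, _))%:R.
have c_ge0 : 0 <= 2 * c by rewrite mulr_ge0.
have := ler_wpM2l c_ge0 (@weight_ineq0 R k%:R m%:R (ler0n _ _) (ler0n _ _)).
have := ler0n R k; have := ler0n R m.
rewrite -!natr1 !natrD => ? ?.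
by congr (_ <= _); field; rewrite ?gt_eqF //; lra.
Qed.

Lemma weight_left (R : realType) n k : (k <= n)%N ->
  weight R n.+1 k + renorm R n.+2 k.+1 <= weight R n.+2 k.+1.
Proof.
case: k => [|k] le_kn.
  by rewrite {1}/weight mul0r invr0 !mulr0 add0r renorm_le_weight.
have [m ->] : exists m, n = (k.+1 + m)%N by exists (n - k.+1)%N; rewrite subnKC.
rewrite renormE ?leq_addr // /weight (binS_left R _ k.+1).
set c := ('C(_, _))%:R.
have c_ge0 : 0 <= 2 * c by rewrite mulr_ge0.
have := ler_wpM2l c_ge0 (@weight_ineq R k%:R m%:R (ler0n _ _) (ler0n _ _)).
have := ler0n R k; have := ler0n R m.
rewrite -!natr1 !natrD => ? ?.
by congr (_ <= _); field; rewrite ?gt_eqF //; lra.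
Qed.

Lemma weight_sub (R : realType) n k : (k <= n)%N ->
  weight R n (n - k)%N = weight R n k.
Proof.
move=> le_kn; rewrite /weight bin_sub // natrB // subKr.
by rewrite [k%:R * _]mulrC.
Qed.

Lemma renorm_sub (R : realType) n k : (k <= n)%N ->
  renorm R n.+2 (n - k).+1 = renorm R n.+2 k.+1.
Proof.
move=> le_kn; rewrite !renormE ?leq_subr //.
have -> : 'C(n.+2, (n - k).+1) = 'C(n.+2, k.+1).
  by rewrite -subSn // -subSS bin_sub // ltnS leqW.
by congr (_ / _ * _); rewrite -!natr1 natrB //; ring.
Qed.

(** Exchanging the letters and reversing the block swaps [k] with [n - k], so
    this is [weight_left] for [n - k]. *)
Lemma weight_right (R : realType) n k : (k <= n)%N ->
  weight R n.+1 k.+1 + renorm R n.+2 k.+1 <= weight R n.+2 k.+1.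
Proof.
move=> le_kn; have := weight_left R (leq_subr k n).
rewrite renorm_sub // -(@weight_sub _ n.+1 k.+1) // subSS.
by rewrite -(@weight_sub _ n.+2 k.+1) ?ltnS ?leqW // subSS subSn.
Qed.

(** By induction on [n] along the self-similarity: each half adds at most
    [renorm] to the bound of the row below, which [weight_left] and
    [weight_right] absorb. *)
Lemma centered_le (R : realType) n k (t : R) : (k <= n.+1)%N -> 0 <= t <= 1 ->
  `|centered n.+1 k t| <= weight R n.+1 k.
Proof.
elim: n k t => [|n IHn] k t le_kn t01.
  rewrite centered_letter ?normr0 ?weight_ge0 //.
  by case: k le_kn => [|[|]] //.
case: k le_kn => [_|k].
  by rewrite centered_letter ?normr0 ?weight_ge0 ?bin0.
rewrite ltnS leq_eqVlt => /predU1P[->|le_kn].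
  by rewrite centered_letter ?normr0 ?weight_ge0 ?binn.
rewrite ltnS in le_kn.
have D_ge0 := renorm_ge0 R le_kn.
have [[s s01 ->]|[s s01 ->]] := unit_split (frac_itv R le_kn) t01.
  rewrite centered_left // (le_trans _ (weight_left R le_kn)) //.
  rewrite (le_trans (ler_normD _ _)) // lerD ?IHn ?(leqW le_kn) //.
  case/andP: s01 => s_ge0 s_le1.
  by rewrite ger0_norm ?mulr_ge0 // ler_piMl.
case/andP: (s01) => s_ge0 s_le1.
rewrite centered_right // (le_trans _ (weight_right R le_kn)) //.
rewrite (le_trans (ler_normD _ _)) // lerD ?IHn //.
have s1_ge0 : 0 <= 1 - s by rewrite subr_ge0.
by rewrite ger0_norm ?mulr_ge0 // ler_piMl // gerBl.
Qed.

(** * Recursion and bound for the renormalized curve *)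

Lemma renorm_gt0 (R : realType) n k : (k <= n)%N -> 0 < renorm R n.+2 k.+1.
Proof.
move=> le_kn; rewrite renormE //.
rewrite !mulr_gt0 ?invr_gt0 ?mulr_gt0 ?exprn_gt0 ?ltr0n ?bin_gt0 ?ltnS ?leqW //.
by rewrite subr_gt0 ltr_nat ltnS.
Qed.

(** The coefficient in front of the curve below is the quotient of the two
    denominators; it tends to [p] when [k / n] does. *)
Lemma renorm_curve_left (R : realType) n k (s : R) :
  (k <= n)%N -> 0 <= s <= 1 ->
  renorm_curve n.+3 k.+2 (s * (k.+2%:R / n.+3%:R)) =
  k.+1%:R * n.+3%:R / (n.+2%:R * n.+1%:R) * renorm_curve n.+2 k.+1 s + s.
Proof.
move=> le_kn s01; have D_gt0 := @renorm_gt0 R n.+1 k.+1 le_kn.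
have ratioE : renorm R n.+2 k.+1 =
    k.+1%:R * n.+3%:R / (n.+2%:R * n.+1%:R) * renorm R n.+3 k.+2.
  rewrite !renormE // (binS_left R n.+1 k.+1) -!natr1.
  by field; rewrite !gt_eqF //; have := ler0n R n; lra.
rewrite {1}/renorm_curve -/(centered _ _ _) centered_left //.
rewrite mulrDl mulfK ?gt_eqF //; congr (_ + _).
rewrite /renorm_curve -/(centered _ _ _) ratioE; field.
by rewrite !gt_eqF //; have := ler0n R n; have := ler0n R k; lra.
Qed.

Lemma renorm_curve_right (R : realType) n k (s : R) :
  (k <= n)%N -> 0 <= s <= 1 ->
  renorm_curve n.+3 k.+1 (k.+1%:R / n.+3%:R + s * (1 - k.+1%:R / n.+3%:R)) =
  (n.+1%:R - k%:R) * n.+3%:R / (n.+2%:R * n.+1%:R) * renorm_curve n.+2 k.+1 s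
  + (1 - s).
Proof.
move=> le_kn /andP[s_ge0 s_le1].
have le_kn1 := leqW le_kn; have D_gt0 := @renorm_gt0 R n.+1 k le_kn1.
have ltnk : k%:R < n%:R + 1 :> R by rewrite natr1 ltr_nat ltnS.
have ratioE : renorm R n.+2 k.+1 =
    (n.+1%:R - k%:R) * n.+3%:R / (n.+2%:R * n.+1%:R) * renorm R n.+3 k.+1.
  rewrite !renormE // (@binS_right R n.+1 k) // -!natr1.
  by field; rewrite !gt_eqF //; have := ler0n R n; lra.
rewrite {1}/renorm_curve -/(centered _ _ _) centered_right //.
rewrite mulrDl mulfK ?gt_eqF //; congr (_ + _).
rewrite /renorm_curve -/(centered _ _ _) ratioE -!natr1; field.
by rewrite !gt_eqF //; have := ler0n R n; lra.
Qed.

Lemma renorm_curve_le (R : realType) n k (t : R) :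
  (0 < k < n)%N -> 0 <= t <= 1 ->
  `|renorm_curve n k t| <= (k%:R / n%:R * (1 - k%:R / n%:R)) ^- 2.
Proof.
case: n k => [|[|n]] [|k] //= le_kn t01; rewrite !ltnS in le_kn.
have D_gt0 := renorm_gt0 R le_kn.
have C_gt0 : 0 < ('C(n.+2, k.+1))%:R :> R by rewrite ltr0n bin_gt0 ltnS leqW.
rewrite /renorm_curve -/(centered _ _ _) normrM normfV (gtr0_norm D_gt0).
rewrite ler_pdivrMr // (le_trans (centered_le _ t01)) ?ltnS ?leqW //.
have ltnk : k%:R < n%:R + 1 :> R by rewrite natr1 ltr_nat ltnS.
have k_ge0 := ler0n R k.
rewrite renormE // /weight -[leRHS](_ : 2 * ('C(n.+2, k.+1))%:R *
  (n.+2%:R / (k.+1%:R * (n.+2%:R - k.+1%:R)) * (n.+2%:R / n.+1%:R)) = _).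
  rewrite ler_wpM2l ?mulr_ge0 // ler_peMr //.
    by rewrite divr_ge0 ?mulr_ge0 // subr_ge0 ler_nat !ltnS leqW.
  by rewrite ler_pdivlMr ?ltr0Sn // mul1r ler_nat.
by rewrite -!natr1; field; rewrite !gt_eqF //; lra.
Qed.

(** * The limit curve as a fixed point *)

Definition contraction (R : realType) (p : R) : R := Num.max p (1 - p).

Lemma contraction_itv (R : realType) (p : R) :
  0 < p < 1 -> 0 < contraction p < 1.
Proof.
move=> /andP[p_gt0 p_lt1].
by rewrite /contraction lt_max p_gt0 gt_max p_lt1 gtrBl.
Qed.

(** The shear terms of the two affine maps, [x] on the left of [p] and [1 - x]
    on the right, as a function of the abscissa [t] of the image point. *)
Definition tent (R : realType) (p t : R) : R :=
  Num.max 0 (Num.min (t / p) ((1 - t) / (1 - p))).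

(** The effect on graphs of the two affine maps. For a function that vanishes
    outside the open unit interval only one of the two copies is nonzero at a
    given [t], so that they can be added: no case distinction at [p] is
    required and continuity is inherited term by term. *)
Definition rescale (R : realType) (p : R) (f : R -> R) (t : R) : R :=
  p * f (t / p) + (1 - p) * f ((t - p) / (1 - p)) + tent p t.

Definition approx (R : realType) (p : R) (j : nat) : R -> R :=
  iter j (rescale p) (fun=> 0).

Definition limit_curve (R : realType) (p t : R) : R :=
  limn (fun j => approx p j t).

Definition supported01 (R : realType) (f : R -> R) : Prop :=
  forall t, t <= 0 \/ 1 <= t -> f t = 0.

Section Rescale.
Variables (R : realType) (p : R).
Hypothesis p01 : 0 < p < 1.
Implicit Types (f g : R -> R) (s t d : R).

Let p_gt0 : 0 < p. Proof. by case/andP: p01. Qed.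
Let q_gt0 : 0 < 1 - p. Proof. by rewrite subr_gt0; case/andP: p01. Qed.

Lemma tent_ge0 t : 0 <= tent p t.
Proof. by rewrite /tent le_max lexx. Qed.

Lemma tent_out t : t <= 0 \/ 1 <= t -> tent p t = 0.
Proof.
move=> t_out; apply/max_idPl; rewrite ge_min.
case: t_out => [t_le0|t_ge1]; apply/orP; [left|right].
  by rewrite pmulr_lle0 ?invr_gt0.
by rewrite pmulr_lle0 ?invr_gt0 // subr_le0.
Qed.

Lemma tent_left s : 0 <= s <= 1 -> tent p (s * p) = s.
Proof.
move=> /andP[s_ge0 s_le1]; rewrite /tent mulfK ?gt_eqF //.
rewrite (min_idPl _) ?(max_idPr _) // ler_pdivlMr //; nra.
Qed.

Lemma tent_right s : 0 <= s <= 1 -> tent p (p + s * (1 - p)) = 1 - s.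
Proof.
move=> /andP[s_ge0 s_le1]; have s1_ge0 : 0 <= 1 - s by rewrite subr_ge0.
rewrite /tent (_ : (1 - _) / _ = 1 - s); last by field; rewrite gt_eqF.
rewrite (min_idPr _) ?(max_idPr _) // ler_pdivlMr //.
have : 0 <= s * (1 - p) by rewrite mulr_ge0 // ltW.
have : 0 <= s * p by rewrite mulr_ge0 // ltW.
nra.
Qed.

Lemma arg_left_out t : p <= t -> 1 <= t / p.
Proof. by move=> le_pt; rewrite ler_pdivlMr ?mul1r. Qed.

Lemma arg_right_out t : t <= p -> (t - p) / (1 - p) <= 0.
Proof. by move=> le_tp; rewrite pmulr_lle0 ?invr_gt0 // subr_le0. Qed.

Lemma rescale_left f s : supported01 f -> 0 <= s <= 1 ->
  rescale p f (s * p) = p * f s + s.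
Proof.
move=> f0 s01; rewrite /rescale tent_left // mulfK ?gt_eqF //.
case/andP: s01 => s_ge0 s_le1.
rewrite [f ((_ - _) / _)]f0 ?mulr0 ?addr0 //; left.
by rewrite arg_right_out // ler_piMl // ltW.
Qed.

Lemma rescale_right f s : supported01 f -> 0 <= s <= 1 ->
  rescale p f (p + s * (1 - p)) = (1 - p) * f s + (1 - s).
Proof.
move=> f0 s01; rewrite /rescale tent_right // (_ : (_ - p) / _ = s); last first.
  by rewrite addrC addKr mulfK ?gt_eqF.
case/andP: s01 => s_ge0 s_le1.
rewrite [f (_ / p)]f0 ?mulr0 ?add0r //; right.
by rewrite arg_left_out // lerDl mulr_ge0 // ltW.
Qed.

Lemma rescale_supported f : supported01 f -> supported01 (rescale p f).
Proof.
move=> f0 t t_out; rewrite /rescale tent_out // addr0.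
case: t_out => [t_le0|t_ge1].
  rewrite !f0 ?mulr0 ?addr0 //; left.
    by rewrite arg_right_out // (le_trans t_le0) ?ltW.
  by rewrite pmulr_lle0 ?invr_gt0.
rewrite !f0 ?mulr0 ?addr0 //; right.
  by rewrite ler_pdivlMr // mul1r lerD2r.
by rewrite arg_left_out // (le_trans _ t_ge1) ?ltW //; case/andP: p01.
Qed.

Lemma rescale_contract f g d : supported01 f -> supported01 g ->
  (forall t, `|f t - g t| <= d) ->
  forall t, `|rescale p f t - rescale p g t| <= contraction p * d.
Proof.
move=> f0 g0 le_d t; have d_ge0 := le_trans (normr_ge0 _) (le_d 0).
rewrite /rescale opprD addrACA subrr addr0.
have [le_tp|/ltW le_pt] := leP t p.
  have a0 := arg_right_out le_tp.
  rewrite (f0 ((t - p) / _)) ?(g0 ((t - p) / _)); try by left.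
  rewrite !mulr0 !addr0 -mulrBr normrM gtr0_norm // ler_pM ?le_max ?lexx //.
  exact: ltW.
have a1 := arg_left_out le_pt.
rewrite (f0 (t / _)) ?(g0 (t / _)); try by right.
rewrite !mulr0 !add0r -mulrBr normrM gtr0_norm // ler_pM ?le_max ?lexx ?orbT //.
exact: ltW.
Qed.

End Rescale.

Lemma max0_lip (R : realType) (a b : R) :
  `|Num.max 0 a - Num.max 0 b| <= `|a - b|.
Proof.
rewrite ler_norml; have := ler_norm (a - b); have := ler_norm (b - a).
rewrite (distrC b a).
by case: (leP 0 a) => ?; case: (leP 0 b) => ? ? ?; apply/andP; split; lra.
Qed.

Lemma min_lip (R : realType) (a b c d : R) :
  `|Num.min a b - Num.min c d| <= `|a - c| + `|b - d|.
Proof.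
rewrite ler_norml; have := ler_norm (a - c); have := ler_norm (c - a).
have := ler_norm (b - d); have := ler_norm (d - b).
have := normr_ge0 (a - c); have := normr_ge0 (b - d).
rewrite (distrC c a) (distrC d b).
case: (leP a b) => ?; case: (leP c d) => ? ? ? ? ? ? ?.
all: by apply/andP; split; lra.
Qed.

Section LimitCurve.
Variables (R : realType) (p : R).
Hypothesis p01 : 0 < p < 1.

Let p_gt0 : 0 < p. Proof. by case/andP: p01. Qed.
Let q_gt0 : 0 < 1 - p. Proof. by rewrite subr_gt0; case/andP: p01. Qed.
Let lam_gt0 : 0 < contraction p.
Proof. by case/andP: (contraction_itv p01). Qed.
Let lam_lt1 : contraction p < 1.
Proof. by case/andP: (contraction_itv p01). Qed.

Let bound : R := (1 - contraction p)^-1.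

Let bound_gt0 : 0 < bound. Proof. by rewrite invr_gt0 subr_gt0. Qed.

Lemma approx_supported j : supported01 (approx p j).
Proof. by elim: j => [|j IHj] //=; exact: rescale_supported. Qed.

Lemma tent_le1 t : tent p t <= 1.
Proof.
rewrite /tent ge_max ler01 /= ge_min.
have [le_tp|/ltW le_pt] := leP t p.
  by rewrite ler_pdivrMr ?mul1r ?le_tp.
by rewrite orbC ler_pdivrMr ?mul1r ?lerD2l ?lerN2 ?le_pt.
Qed.

Lemma approx_nondecreasing t : nondecreasing_seq (fun j => approx p j t).
Proof.
apply/nondecreasing_seqP => j; elim: j t => [|j IHj] t /=.
  by rewrite /rescale !mulr0 !add0r tent_ge0.
by rewrite lerD2r lerD // ler_pM2l.
Qed.

Lemma rescale0 t : rescale p (fun=> 0) t = tent p t.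
Proof. by rewrite /rescale !mulr0 !add0r. Qed.

Lemma approx_bound j t : `|approx p j t| <= bound.
Proof.
elim: j t => [|j IHj] t; first by rewrite normr0 ltW.
have c0 : supported01 (fun=> 0 : R) by [].
have := rescale_contract p01 (@approx_supported j) c0.
move=> /(_ bound) le_c.
rewrite -[approx _ _ _](subrK (tent p t)) (le_trans (ler_normD _ _)) //.
rewrite [leRHS](_ : bound = contraction p * bound + 1); last first.
  by rewrite /bound; field; rewrite gt_eqF // subr_gt0.
rewrite lerD ?(ger0_norm (tent_ge0 _ _)) ?tent_le1 //.
by rewrite -rescale0; apply: le_c => s; rewrite subr0.
Qed.

(** The iterates from [0] increase, because the tent is nonnegative, and are
    bounded by the geometric series of the contraction factor. *)
Lemma approx_cvg t : approx p j t @[j --> \oo] --> limit_curve p t.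
Proof.
apply: nondecreasing_is_cvgn; first exact: approx_nondecreasing.
by exists bound => _ [j _ <-]; exact: le_trans (ler_norm _) (approx_bound j t).
Qed.

Lemma limit_curve_supported : supported01 (limit_curve p).
Proof.
move=> t t_out; apply: cvg_lim => //.
rewrite (_ : (fun j => _) = cst 0); first exact: cvg_cst.
by apply/funext => j; exact: approx_supported.
Qed.

Lemma limit_curve_bound t : `|limit_curve p t| <= bound.
Proof.
have /cvg_norm c := @approx_cvg t.
rewrite -(cvg_lim _ c) //; apply: limr_le; first by apply: cvgP c.
by apply: nearW => j; exact: approx_bound.
Qed.

Lemma limit_curve_fix t : limit_curve p t = rescale p (limit_curve p) t.
Proof.
have := @approx_cvg t; rewrite -(cvg_shiftS (fun j => approx p j t)) => c.
apply: (cvg_unique _ c) => //=.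
apply: cvgD; last exact: cvg_cst.
by apply: cvgD; apply: cvgM; (exact: cvg_cst || exact: approx_cvg).
Qed.

Lemma limit_curve_left s : 0 <= s <= 1 ->
  limit_curve p (s * p) = p * limit_curve p s + s.
Proof.
move=> s01; rewrite limit_curve_fix rescale_left //.
exact: limit_curve_supported.
Qed.

Lemma limit_curve_right s : 0 <= s <= 1 ->
  limit_curve p (p + s * (1 - p)) = (1 - p) * limit_curve p s + (1 - s).
Proof.
move=> s01; rewrite limit_curve_fix rescale_right //.
exact: limit_curve_supported.
Qed.

Lemma approx_near_limit j t :
  `|limit_curve p t - approx p j t| <= contraction p ^+ j * bound.
Proof.
elim: j t => [|j IHj] t; first by rewrite subr0 mul1r limit_curve_bound.
rewrite limit_curve_fix exprS -mulrA.
by apply: (rescale_contract p01 limit_curve_supported (@approx_supported j)).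
Qed.

Lemma tent_lip x y : `|tent p x - tent p y| <= (p^-1 + (1 - p)^-1) * `|x - y|.
Proof.
apply: le_trans (max0_lip _ _) _; apply: le_trans (min_lip _ _ _ _) _.
rewrite -!mulrBl (_ : 1 - x - (1 - y) = y - x); last by ring.
rewrite !normrM !normfV (gtr0_norm p_gt0) (gtr0_norm q_gt0).
by rewrite (distrC y x) mulrDl lerD // mulrC.
Qed.

Lemma approx_lip j :
  exists2 L, 0 <= L &
    forall x y, `|approx p j x - approx p j y| <= L * `|x - y|.
Proof.
elim: j => [|j [L L_ge0 lip]].
  by exists 0 => // x y; rewrite subrr normr0 mul0r.
exists (L + L + (p^-1 + (1 - p)^-1)) => [|x y].
  by rewrite !addr_ge0 ?invr_ge0 ?(ltW p_gt0) ?(ltW q_gt0).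
rewrite /= /rescale.
rewrite (_ : _ - _ = p * (approx p j (x / p) - approx p j (y / p))
  + (1 - p) * (approx p j ((x - p) / (1 - p)) - approx p j ((y - p) / (1 - p)))
  + (tent p x - tent p y)); last by ring.
rewrite [leRHS](_ : _ = L * `|x - y| + L * `|x - y|
  + (p^-1 + (1 - p)^-1) * `|x - y|); last by ring.
apply: le_trans (ler_normD _ _) _; rewrite lerD ?tent_lip //.
apply: le_trans (ler_normD _ _) _.
rewrite !normrM (gtr0_norm p_gt0) (gtr0_norm q_gt0) lerD //.
  rewrite (le_trans (ler_wpM2l (ltW p_gt0) (lip _ _))) //.
  rewrite -mulrBl normrM normfV (gtr0_norm p_gt0).
  by rewrite le_eqVlt; apply/predU1P; left; field; rewrite gt_eqF.
rewrite (le_trans (ler_wpM2l (ltW q_gt0) (lip _ _))) //.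
rewrite -mulrBl (_ : x - p - (y - p) = x - y); last by ring.
rewrite normrM normfV (gtr0_norm q_gt0).
by rewrite le_eqVlt; apply/predU1P; left; field; rewrite gt_eqF.
Qed.

(** An iterate that is uniformly close to the limit is Lipschitz, with a
    constant that grows with the number of iterations. *)
Lemma limit_curve_unif (e : R) : 0 < e ->
  exists2 d, 0 < d &
    forall x y, `|x - y| <= d -> `|limit_curve p x - limit_curve p y| <= e.
Proof.
move=> e_gt0.
have [j lej] : exists j, contraction p ^+ j * bound <= e / 3.
  have /cvgrPdist_le : contraction p ^+ j @[j --> \oo] --> (0 : R).
    by apply: cvg_expr; rewrite gtr0_norm.
  have e' : 0 < e / 3 / bound by rewrite !divr_gt0.
  move=> /(_ _ e') [j _ /(_ j (leqnn j))] /=.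
  rewrite sub0r normrN normrX (gtr0_norm lam_gt0) => le_e.
  by exists j; rewrite -ler_pdivlMr.
have [L L_ge0 lip] := approx_lip j.
exists (e / 3 / (L + 1)); first by rewrite !divr_gt0 // ltr_wpDl.
move=> x y; rewrite ler_pdivlMr ?ltr_wpDl // => le_d.
have := approx_near_limit j x; have := approx_near_limit j y; have := lip x y.
have := normr_ge0 (x - y).
rewrite [X in X <= e](_ : _ = `|(limit_curve p x - approx p j x)
  + (approx p j x - approx p j y) - (limit_curve p y - approx p j y)|);
    last first.
  by congr `|_|; ring.
move=> ? ? ? ?; apply: le_trans (ler_normB _ _) _.
have := ler_normD (limit_curve p x - approx p j x)
                  (approx p j x - approx p j y).
nra.
Qed.

Lemma limit_curve_continuous : continuous (limit_curve p).
Proof.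
move=> x; apply/cvgrPdist_le => e e_gt0.
have [d d_gt0 unif] := limit_curve_unif e_gt0.
near=> y; apply: unif.
by near: y; apply: cvgr_dist_le.
Unshelve. all: by end_near. Qed.

End LimitCurve.

(** * The attractor is the graph of the limit curve *)

Section Attractor.
Variables (R : realType) (p : R).
Hypothesis p01 : 0 < p < 1.
Implicit Types (E : set (R * R)) (z : R * R) (t : R).

Let p_gt0 : 0 < p. Proof. by case/andP: p01. Qed.
Let q_gt0 : 0 < 1 - p. Proof. by rewrite subr_gt0; case/andP: p01. Qed.

Definition graph : set (R * R) := (fun t => (t, limit_curve p t)) @` `[0, 1].

Lemma graph_is_attractor : is_attractor p graph.
Proof.
split.
- by exists (0, limit_curve p 0), 0 => //=; rewrite in_itv /= lexx ler01.
- apply: continuous_compact; last exact: segment_compact.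
  apply: continuous_subspaceT => x.
  apply: (@cvg_pair _ _ _ _ (nbhs x) (nbhs (limit_curve p x))).
    exact: cvg_id.
  exact: (limit_curve_continuous p01).
- by move=> _ [t t01 <-]; split.
apply/seteqP; split.
  move=> _ [t t01 <-]; rewrite /= in_itv /= in t01.
  have [[s s01 ->]|[s s01 ->]] := unit_split p01 t01; [left | right].
    exists (s, limit_curve p s); first by exists s; rewrite //= in_itv.
    by rewrite /alphaL /= limit_curve_left // mulrC.
  exists (s, limit_curve p s); first by exists s; rewrite //= in_itv.
  rewrite /alphaR /= limit_curve_right //; congr (_, _); ring.
move=> _ [] [_ [s s01 <-] <-]; rewrite /= in_itv /= in s01.
  exists (s * p); last by rewrite /alphaL /= limit_curve_left // mulrC.
  case/andP: s01 => s_ge0 s_le1; rewrite /= in_itv /= mulr_ge0 ?(ltW p_gt0) //=.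
  by case/andP: p01 => _ /ltW p_le1; exact: mulr_ile1 (ltW p_gt0) s_le1 p_le1.
exists (p + s * (1 - p)); last first.
  rewrite /alphaR /= limit_curve_right //; congr (_, _); ring.
case/andP: s01 => s_ge0 s_le1; rewrite /= in_itv /=.
rewrite addr_ge0 ?mulr_ge0 ?(ltW p_gt0) ?(ltW q_gt0) //=.
by rewrite -lerBrDl ler_piMl // ltW.
Qed.

(** The two maps shrink the vertical distance to the limit curve, so a bounded
    invariant set lies at distance zero from it. *)
Lemma attractor_sub_graph E : is_attractor p E ->
  forall z, E z -> z.2 = limit_curve p z.1.
Proof.
case=> _ E_compact E_sub E_inv.
have [B B_ge0 le_B] : exists2 B, 0 <= B &
    forall z, E z -> `|z.2 - limit_curve p z.1| <= B.
  have /compact_bounded[M [_ le_M]] : compact (snd @` E).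
    apply: continuous_compact => //; apply: continuous_subspaceT => z.
    exact: cvg_snd.
  have M1 : M < `|M| + 1 by rewrite ltr_pwDr // ler_norm.
  exists (`|M| + 1 + (1 - contraction p)^-1).
    rewrite !addr_ge0 // invr_ge0 subr_ge0 ltW //.
    by case/andP: (contraction_itv p01).
  move=> z Ez; apply: le_trans (ler_normB _ _) _.
  rewrite lerD ?(limit_curve_bound p01) //.
  by apply: (le_M _ M1); exists z.
have shrink j z : E z -> `|z.2 - limit_curve p z.1| <= contraction p ^+ j * B.
  elim: j z => [|j IHj] z Ez; first by rewrite mul1r le_B.
  have d_ge0 := le_trans (normr_ge0 _) (IHj z Ez).
  move: Ez; rewrite {1}E_inv exprS -mulrA => -[[w Ew <-]|[w Ew <-]];
    have [/= w01 _] := E_sub w Ew; rewrite in_itv /= in w01.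
    rewrite /alphaL /= (mulrC p w.1) limit_curve_left //.
    rewrite (_ : _ - _ = p * (w.2 - limit_curve p w.1)); last by ring.
    by rewrite normrM gtr0_norm // ler_pM ?IHj ?(ltW p_gt0) // le_max lexx.
  rewrite /alphaR /= (_ : (1 - p) * w.1 + p = p + w.1 * (1 - p)); last by ring.
  rewrite limit_curve_right //.
  rewrite (_ : _ - _ = (1 - p) * (w.2 - limit_curve p w.1)); last by ring.
  by rewrite normrM gtr0_norm // ler_pM ?IHj ?(ltW q_gt0) // le_max lexx orbT.
move=> z Ez; apply/eqP; rewrite -subr_eq0 -normr_le0.
have lim0 : contraction p ^+ j * B @[j --> \oo] --> (0 : R).
  rewrite -(mul0r B); apply: cvgMl; apply: cvg_expr.
  by case/andP: (contraction_itv p01) => ? ?; rewrite gtr0_norm.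
rewrite -(cvg_lim _ lim0) //; apply: limr_ge; first by apply: cvgP lim0.
by apply: nearW => j; exact: shrink.
Qed.

(** The abscissas of an attractor form an invariant set for the two
    contractions of the unit interval, whose images cover the interval; hence
    they are dense. *)
Lemma attractor_approx E j t : is_attractor p E -> 0 <= t <= 1 ->
  exists2 z, E z & `|z.1 - t| <= contraction p ^+ j.
Proof.
move=> E_attr; have [[z0 Ez0] _ E_sub E_inv] := E_attr.
elim: j t => [|j IHj] t t01.
  exists z0 => //; have [/= + _] := E_sub _ Ez0; rewrite in_itv /= => z01.
  rewrite ler_norml; case/andP: t01; case/andP: z01 => *.
  by apply/andP; split; lra.
have [[s s01 ->]|[s s01 ->]] := unit_split p01 t01;
  have [w Ew le_w] := IHj s s01.
  exists (alphaL p w); first by rewrite E_inv; left; exists w.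
  rewrite exprS /= (mulrC s) -mulrBr normrM gtr0_norm // ler_pM ?(ltW p_gt0) //.
  by rewrite le_max lexx.
exists (alphaR p w); first by rewrite E_inv; right; exists w.
rewrite exprS /= (_ : _ - _ = (1 - p) * (w.1 - s)); last by ring.
by rewrite normrM gtr0_norm // ler_pM ?(ltW q_gt0) // le_max lexx orbT.
Qed.

Lemma attractor_projection E t : is_attractor p E -> 0 <= t <= 1 ->
  exists y, E (t, y).
Proof.
move=> E_attr t01; have [_ E_compact _ _] := E_attr.
have closed_proj : closed (fst @` E).
  apply: compact_closed; first exact: Rhausdorff.
  apply: continuous_compact => //; apply: continuous_subspaceT => z.
  exact: cvg_fst.
suff [z Ez <-] : (fst @` E) t by exists z.2; rewrite -surjective_pairing.
apply: closed_proj => U /nbhs_ballP[e /= e_gt0 ball_U].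
have /cvgrPdist_lt/(_ e e_gt0)[j _ /(_ j (leqnn j)) /= lt_e] :
    contraction p ^+ j @[j --> \oo] --> (0 : R).
  apply: cvg_expr; case/andP: (contraction_itv p01) => ? ?.
  by rewrite gtr0_norm.
have [z Ez le_z] := attractor_approx j E_attr t01.
exists z.1; split; first by exists z.
apply: ball_U; rewrite /ball /= distrC (le_lt_trans le_z) //.
by rewrite (le_lt_trans (ler_norm _)) // -normrN -sub0r.
Qed.

Lemma blancmangeE t : 0 <= t <= 1 -> blancmange p t = limit_curve p t.
Proof.
move=> t01; have A_attr : is_attractor p (attractor p).
  exact: (xgetI set0 graph_is_attractor).
have [y Ay] := attractor_projection A_attr t01.
have := @xgetPex _ 0 [set y | attractor p (t, y)] (ex_intro _ y Ay).
exact: (attractor_sub_graph A_attr).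
Qed.

End Attractor.

(** * Convergence of the renormalized curves *)

Section Convergence.
Variables (R : realType) (p : R).
Hypothesis p01 : 0 < p < 1.
Implicit Types (k : nat -> nat) (t s d : R).

Let p_gt0 : 0 < p. Proof. by case/andP: p01. Qed.
Let q_gt0 : 0 < 1 - p. Proof. by rewrite subr_gt0; case/andP: p01. Qed.
Let lam_gt0 : 0 < contraction p.
Proof. by case/andP: (contraction_itv p01). Qed.
Let lam_lt1 : contraction p < 1.
Proof. by case/andP: (contraction_itv p01). Qed.
Let p_lam : p <= contraction p. Proof. by rewrite le_max lexx. Qed.
Let q_lam : 1 - p <= contraction p. Proof. by rewrite le_max lexx orbT. Qed.

Definition admissible k : Prop :=
  (forall n, (k n <= n)%N) /\ (k n)%:R / n%:R @[n --> \oo] --> p.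

(** The weight of vertical distances against horizontal ones. The shear terms
    turn a horizontal error into a vertical one of the same size, so the
    weighted distance is multiplied by up to [contraction p + vscale]; the
    factor [1 / 3] leaves room below [1] for one more [vscale], spent in
    [eventually_near_step] on the other errors. *)
Definition vscale : R := (1 - contraction p) / 3.

Let c_gt0 : 0 < vscale. Proof. by rewrite divr_gt0 // subr_gt0. Qed.

(** Allowing a horizontal displacement makes this stable under the recursion:
    at equal abscissas, the curve and its limit are cut at the different
    points [k / n] and [p], and a point between them lies in different halves.
    *)
Definition near_graph (n k : nat) (d : R) : Prop :=
  forall t, 0 <= t <= 1 -> exists2 t', 0 <= t' <= 1 &
    `|t - t'| + vscale * `|renorm_curve n k t - limit_curve p t'| <= d.

(** One step of the recursion, for either half: [a] is the limit contraction
    factor, [r] the actual one, [q0] the error on the cut point, [f] and [g]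
    are the heights of a point of the curve below and of a point of the limit
    graph close to it, and [x], [y] are the horizontal and vertical errors
    after the step. *)
Lemma step_estimate (a : R) (r q0 : R) s s' (f g d e K : R) :
  0 <= a <= contraction p -> 0 <= s <= 1 ->
  `|q0| <= e -> `|r - a| <= 2 * e -> `|f| <= K ->
  `|s - s'| + vscale * `|f - g| <= d ->
  forall x y : R, `|x| <= `|q0| + a * `|s - s'| ->
  `|y| <= `|r - a| * `|f| + a * `|f - g| + `|s - s'| ->
  `|x| + vscale * `|y| <=
    e * (1 + 2 * vscale * K) + (contraction p + vscale) * d.
Proof.
move=> /andP[a_ge0 a_le] s01 le_q le_r le_f le_d x y le_x le_y.
have le_rf : `|r - a| * `|f| <= 2 * e * K by rewrite ler_pM.
have le_cy := ler_wpM2l (ltW c_gt0) le_y.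
have le_crf := ler_wpM2l (ltW c_gt0) le_rf.
have h_ge0 : 0 <= `|s - s'| by [].
have v_ge0 : 0 <= vscale * `|f - g| by rewrite mulr_ge0 // ltW.
have le_ah := ler_wpM2r h_ge0 a_le.
have le_av := ler_wpM2r v_ge0 a_le.
have le_dd : (contraction p + vscale) * (`|s - s'| + vscale * `|f - g|) <=
  (contraction p + vscale) * d by rewrite ler_wpM2l // addr_ge0 ?ltW.
have cv_ge0 : 0 <= vscale * (vscale * `|f - g|) by rewrite mulr_ge0 // ltW.
nra.
Qed.

(** With [x = k + 1] or [x = n + 1 - k], the left-hand side of the conclusion
    is the error on the quotient of two denominators in [renorm_curve_left] or
    [renorm_curve_right]: the quotient is the frequency [x / (n + 2)] of the
    row below, up to a factor [1 + 2 / (n + 1)]. *)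
Lemma coef_estimate (n : nat) (a x e : R) : 0 <= x <= n.+2%:R ->
  `|x / n.+2%:R - a| <= e -> n.+1%:R^-1 <= e / 2 ->
  `|x * n.+3%:R / (n.+2%:R * n.+1%:R) - a| <= 2 * e.
Proof.
move=> /andP[x_ge0 x_le] le_e le_n; have n_ge0 := ler0n R n.
have -> : x * n.+3%:R / (n.+2%:R * n.+1%:R) - a =
  x / n.+2%:R - a + x / n.+2%:R * (2 * n.+1%:R^-1).
  by rewrite -!natr1; field; rewrite !gt_eqF //; lra.
rewrite (le_trans (ler_normD _ _)) // [leRHS](_ : _ = e + e); last by ring.
rewrite lerD //.
rewrite ger0_norm ?mulr_ge0 ?invr_ge0 // (@le_trans _ _ (2 * n.+1%:R^-1)) //.
  by rewrite ler_piMl ?mulr_ge0 ?invr_ge0 // ler_pdivrMr ?mul1r ?ltr0Sn.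
by rewrite mulrC -ler_pdivlMr.
Qed.

Lemma near_graph_left (n k : nat) (d e K : R) : (k <= n)%N ->
  `|k.+2%:R / n.+3%:R - p| <= e -> `|k.+1%:R / n.+2%:R - p| <= e ->
  n.+1%:R^-1 <= e / 2 ->
  (forall s, 0 <= s <= 1 -> `|renorm_curve n.+2 k.+1 s| <= K) ->
  near_graph n.+2 k.+1 d ->
  forall s, 0 <= s <= 1 -> exists2 t', 0 <= t' <= 1 &
    `|s * (k.+2%:R / n.+3%:R) - t'| + vscale *
      `|renorm_curve n.+3 k.+2 (s * (k.+2%:R / n.+3%:R)) - limit_curve p t'|
    <= e * (1 + 2 * vscale * K) + (contraction p + vscale) * d.
Proof.
move=> le_kn le_q le_q' le_n le_K Nd s s01.
have [s' s'01 le_d] := Nd s s01.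
have [s_ge0 s_le1] := andP s01; have [s'_ge0 s'_le1] := andP s'01.
exists (s' * p).
  rewrite mulr_ge0 ?(ltW p_gt0) //=.
  by case/andP: p01 => _ /ltW p_le1; exact: mulr_ile1 (ltW p_gt0) _ p_le1.
rewrite renorm_curve_left // limit_curve_left //.
set r := k.+1%:R * _ / _; set f := renorm_curve _ _ _ in le_d *.
set g := limit_curve _ _ in le_d *; set q := _ / _ in le_q *.
apply: (@step_estimate p r (q - p) s s' f g d e K) => //.
- by rewrite (ltW p_gt0).
- by apply: coef_estimate; rewrite // ler0n ler_nat ltnS leqW.
- exact: le_K.
- rewrite (_ : _ - _ = s * (q - p) + p * (s - s')); last by ring.
  rewrite (le_trans (ler_normD _ _)) // !normrM (gtr0_norm p_gt0) lerD //.
  by rewrite ger0_norm // ler_piMl.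
rewrite (_ : _ - _ = (r - p) * f + p * (f - g) + (s - s')); last by ring.
rewrite (le_trans (ler_normD _ _)) // lerD // (le_trans (ler_normD _ _)) //.
by rewrite !normrM (gtr0_norm p_gt0).
Qed.

Lemma near_graph_right (n k : nat) (d e K : R) : (k <= n)%N ->
  `|k.+1%:R / n.+3%:R - p| <= e -> `|k.+1%:R / n.+2%:R - p| <= e ->
  n.+1%:R^-1 <= e / 2 ->
  (forall s, 0 <= s <= 1 -> `|renorm_curve n.+2 k.+1 s| <= K) ->
  near_graph n.+2 k.+1 d ->
  forall s, 0 <= s <= 1 -> exists2 t', 0 <= t' <= 1 &
    `|k.+1%:R / n.+3%:R + s * (1 - k.+1%:R / n.+3%:R) - t'| + vscale *
      `|renorm_curve n.+3 k.+1
          (k.+1%:R / n.+3%:R + s * (1 - k.+1%:R / n.+3%:R)) - limit_curve p t'|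
    <= e * (1 + 2 * vscale * K) + (contraction p + vscale) * d.
Proof.
move=> le_kn le_q le_q' le_n le_K Nd s s01.
have [s' s'01 le_d] := Nd s s01.
have [s_ge0 s_le1] := andP s01; have [s'_ge0 s'_le1] := andP s'01.
exists (p + s' * (1 - p)).
  rewrite addr_ge0 ?mulr_ge0 ?(ltW p_gt0) ?(ltW q_gt0) //=.
  by rewrite -lerBrDl ler_piMl // ltW.
rewrite renorm_curve_right // limit_curve_right //.
set r := (_ - k%:R) * _ / _; set f := renorm_curve _ _ _ in le_d *.
set g := limit_curve _ _ in le_d *; set q := _ / n.+3%:R in le_q *.
apply: (@step_estimate (1 - p) r (q - p) s s' f g d e K) => //.
- by rewrite (ltW q_gt0).
- apply: coef_estimate => //; first last.
    rewrite (_ : _ - _ = - (k.+1%:R / n.+2%:R - p)) ?normrN // -!natr1.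
    by field; rewrite gt_eqF //; have := ler0n R n; lra.
  have := ler0n R k; have : k%:R <= n%:R :> R by rewrite ler_nat.
  by rewrite -!natr1 => ? ?; apply/andP; split; lra.
- exact: le_K.
- rewrite (_ : _ - _ = (1 - s) * (q - p) + (1 - p) * (s - s')); last by ring.
  rewrite (le_trans (ler_normD _ _)) // !normrM (gtr0_norm q_gt0) lerD //.
  by rewrite ler_piMl // ger0_norm ?subr_ge0 // gerBl.
rewrite (_ : _ - _ = (r - (1 - p)) * f + (1 - p) * (f - g) + (s' - s));
  last by ring.
rewrite (le_trans (ler_normD _ _)) // lerD // ?(distrC s') //.
by rewrite (le_trans (ler_normD _ _)) // !normrM (gtr0_norm q_gt0).
Qed.

(** The two halves of the blocks of an admissible sequence form admissible
    sequences again; the row index drops by one, hence the shift. *)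
Lemma admissible_shift k (j : nat -> nat) : admissible k ->
  (forall n, (j n <= n)%N) ->
  (forall n, (j n <= k n.+1)%N /\ (k n.+1 <= (j n).+1)%N) -> admissible j.
Proof.
move=> [_ k_cvg] j_le jk; split=> //.
have kS_cvg : (k n.+1)%:R / n.+1%:R @[n --> \oo] --> p.
  by rewrite (cvg_shiftS (fun n => (k n)%:R / n%:R : R)).
rewrite -(addr0 p).
have -> : (fun n => (j n)%:R / n%:R : R) = (fun n => (k n.+1)%:R / n.+1%:R +
    ((j n)%:R / n%:R - (k n.+1)%:R / n.+1%:R)).
  by apply/funext => n; rewrite addrC subrK.
apply: cvgD => //.
apply: (@squeeze_cvgr _ _ _ _ (fun n => - harmonic n) harmonic).
- near=> n; have n_gt0 : 0 < n%:R :> R by rewrite ltr0n; near: n; exists 1%N.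
  have [jk1 jk2] := jk n.
  rewrite -(ler_nat R) in jk1; rewrite -(ler_nat R) in jk2.
  have := j_le n; rewrite -(ler_nat R) => jn.
  have j_ge0 := ler0n R (j n).
  have -> : (j n)%:R / n%:R - (k n.+1)%:R / n.+1%:R =
      (((j n)%:R - (k n.+1)%:R) * n%:R + (j n)%:R) / n%:R * n.+1%:R^-1 :> R.
    by rewrite -!natr1; field; rewrite !gt_eqF //; lra.
  rewrite -natr1 in jk2; rewrite /harmonic /=; apply/andP; split.
    by rewrite -[leLHS]mulN1r ler_wpM2r ?invr_ge0 // ler_pdivlMr //; nra.
  by rewrite ler_piMl ?invr_ge0 // ler_pdivrMr //; nra.
- by rewrite -oppr0; apply: cvgN; exact: cvg_harmonic.
- exact: cvg_harmonic.
Unshelve. all: by end_near. Qed.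

Lemma admissible_left k : admissible k -> admissible (fun n => (k n.+1).-1).
Proof.
move=> k_adm; have [k_le _] := k_adm; apply: admissible_shift k_adm _ _ => n.
  by have := k_le n.+1; case: (k n.+1).
by rewrite leq_pred leqSpred.
Qed.

(** The minimum keeps the index in the row when [k n.+1 = n.+1], where the
    block is not cut. *)
Lemma admissible_right k :
  admissible k -> admissible (fun n => minn (k n.+1) n).
Proof.
move=> k_adm; have [k_le _] := k_adm; apply: admissible_shift k_adm _ _ => n.
  exact: geq_minr.
rewrite geq_minl; split=> //; have := k_le n.+1.
by rewrite /minn; case: ltnP.
Qed.

Definition margin : R := Num.min p (1 - p) / 2.

Let margin_gt0 : 0 < margin.
Proof. by rewrite divr_gt0 // lt_min p_gt0. Qed.

Lemma admissible_margin k : admissible k ->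
  \forall n \near \oo, [/\ margin <= (k n)%:R / n%:R,
    margin <= 1 - (k n)%:R / n%:R, (1 < k n)%N & (k n < n.-1)%N].
Proof.
move=> [k_le k_cvg]; near=> n.
have : `|p - (k n)%:R / n%:R| <= margin.
  by near: n; move/cvgrPdist_le : k_cvg; exact.
rewrite ler_norml => /andP[le1 le2].
have lep : margin * 2 <= p by rewrite divfK // ge_min lexx.
have leq : margin * 2 <= 1 - p by rewrite divfK // ge_min lexx orbT.
have n_big : margin^-1 < n%:R by near: n; exact: nbhs_infty_gtr.
have n_gt0 : 0 < n%:R :> R by apply: lt_trans n_big; rewrite invr_gt0.
have mn : 1 < margin * n%:R by rewrite -ltr_pdivrMl // mulr1.
have l1 : margin <= (k n)%:R / n%:R by lra.
have l2 : margin <= 1 - (k n)%:R / n%:R by lra.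
have k1 : 1 < (k n)%:R :> R.
  by rewrite (lt_le_trans mn) // -ler_pdivlMr.
have k2 : (k n)%:R + 1 < n%:R :> R.
  have : margin * n%:R <= n%:R - (k n)%:R.
    by rewrite -ler_pdivlMr // mulrBl divff ?gt_eqF.
  lra.
split=> //; first by rewrite -(ltr_nat R).
by rewrite -(ltr_nat R) -subn1 natrB -?(ltr_nat R) 1?ltrBrDr // -(ltr0n R).
Unshelve. all: by end_near. Qed.

Definition curve_bound : R := (margin * margin) ^- 2.

Let curve_bound_gt0 : 0 < curve_bound.
Proof. by rewrite invr_gt0 exprn_gt0 //; exact: mulr_gt0. Qed.

Lemma admissible_bound k : admissible k ->
  \forall n \near \oo, forall t, 0 <= t <= 1 ->
    `|renorm_curve n (k n) t| <= curve_bound.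
Proof.
move=> /admissible_margin; apply: filterS => n [le1 le2 k1 k2] t t01.
rewrite (le_trans (renorm_curve_le _ t01)) //.
  by rewrite (ltn_trans _ k1) //= (leq_trans k2) // leq_pred.
have x_gt0 := lt_le_trans margin_gt0 le1.
have y_gt0 := lt_le_trans margin_gt0 le2.
have m2_gt0 := mulr_gt0 margin_gt0 margin_gt0.
have xy_gt0 := mulr_gt0 x_gt0 y_gt0.
rewrite lef_pV2 ?posrE ?exprn_gt0 //.
rewrite lerXn2r ?nnegrE ?(ltW m2_gt0) ?(ltW xy_gt0) //.
by rewrite ler_pM // ltW.
Qed.

(** Quantifying over all sequences makes the induction possible: the step from
    [n] to [n.+1] uses the property for the two sequences of halves. *)
Definition eventually_near d : Prop :=
  forall k, admissible k -> \forall n \near \oo, near_graph n (k n) d.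

Lemma eventually_near_init :
  eventually_near (vscale * (curve_bound + (1 - contraction p)^-1)).
Proof.
move=> k /admissible_bound; apply: filterS => n le_K t t01.
exists t => //; rewrite subrr normr0 add0r ler_wpM2l ?(ltW c_gt0) //.
by rewrite (le_trans (ler_normB _ _)) // lerD ?le_K ?limit_curve_bound.
Qed.

Let factor : R := contraction p + 2 * vscale.

Let factor_lt1 : factor < 1.
Proof. by rewrite /factor /vscale; have := lam_lt1; lra. Qed.

Lemma eventually_near_step d :
  0 < d -> eventually_near d -> eventually_near (factor * d).
Proof.
move=> d_gt0 near_d k k_adm.
have K_ge0 := ltW curve_bound_gt0; have c_ge0 := ltW c_gt0.
(* The tolerance on the frequencies for which the errors of [step_estimate]
   that do not contract add up to [vscale * d]. *)
pose e := vscale * d / (1 + 2 * vscale * curve_bound).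
have den_gt0 : 0 < 1 + 2 * vscale * curve_bound.
  by rewrite ltr_pwDl //; exact: mulr_ge0 (mulr_ge0 (ler0n R 2) c_ge0) K_ge0.
have e_gt0 : 0 < e by rewrite divr_gt0 // mulr_gt0.
have freq_near j : admissible j ->
    \forall n \near \oo, `|(j n)%:R / n%:R - p| <= e.
  by case=> _ /cvgrPdist_le/(_ e e_gt0); apply: filterS => n; rewrite distrC.
have inv_near : \forall n \near \oo, n%:R^-1 <= e / 2 :> R.
  near=> n; have n_big : (e / 2)^-1 < n%:R by near: n; exact: nbhs_infty_gtr.
  have e2_gt0 : 0 < (e / 2)^-1 by rewrite invr_gt0 divr_gt0.
  have n_gt0 := lt_trans e2_gt0 n_big.
  by rewrite -[leRHS]invrK lef_pV2 ?posrE // ltW.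
have l_adm := admissible_left k_adm; have r_adm := admissible_right k_adm.
have le_coef : e * (1 + 2 * vscale * curve_bound)
    + (contraction p + vscale) * d = factor * d.
  by rewrite /e divfK ?gt_eqF // /factor; ring.
have [N1 _ near1] : \forall m \near \oo,
    [/\ near_graph m (k m.+1).-1 d, near_graph m (minn (k m.+1) m) d,
        `|(k m.+1).-1%:R / m%:R - p| <= e &
        `|(minn (k m.+1) m)%:R / m%:R - p| <= e] /\
    [/\ forall t, 0 <= t <= 1 -> `|renorm_curve m (k m.+1).-1 t| <= curve_bound,
        forall t, 0 <= t <= 1 ->
           `|renorm_curve m (minn (k m.+1) m) t| <= curve_bound &
        m%:R^-1 <= e / 2].
  near=> m; split; split; near: m.
  - exact: near_d l_adm.
  - exact: near_d r_adm.
  - exact: freq_near l_adm.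
  - exact: freq_near r_adm.
  - exact: admissible_bound l_adm.
  - exact: admissible_bound r_adm.
  - exact: inv_near.
have [N2 _ near2] : \forall n \near \oo,
    `|(k n)%:R / n%:R - p| <= e /\ (1 < k n)%N /\ (k n < n.-1)%N.
  near=> n; split; first by near: n; exact: freq_near k_adm.
  suff : [/\ margin <= (k n)%:R / n%:R, margin <= 1 - (k n)%:R / n%:R,
    (1 < k n)%N & (k n < n.-1)%N] by case.
  by near: n; exact: admissible_margin.
exists (maxn N1.+2 N2) => // n; rewrite /= geq_max => /andP[leN1 /near2].
case: n leN1 => // m; rewrite ltnS => leN1.
have [[nl nr fl fr] [bl br _]] := near1 m (ltnW leN1).
case=> fk [k1 k2] t t01.
have m_gt1 : (1 < m)%N by exact: leq_trans k1 (ltnW k2).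
(* Rows are renamed so that the recursion lemmas apply: the block is [n.+3,
   K.+2], and its halves are [n.+2, K.+1] and [n.+2, K.+2]. *)
case: m m_gt1 => // -[|n] // _ in leN1 nl nr fl fr bl br fk k1 k2 *.
have [_ [_ _ le_inv]] := near1 n.+1 leN1.
case: (k n.+3) nl nr fl fr bl br fk k1 k2 => // -[|K] //=.
move=> nl nr fl fr bl br fk _ k2.
have le_Kn : (K < n)%N by [].
have minE : minn K.+2 n.+2 = K.+2 by apply/minn_idPl; rewrite !ltnS ltnW.
rewrite minE in nr fr br.
have q01 : 0 < (K.+2%:R / n.+3%:R : R) < 1.
  exact: (@frac_itv _ n.+1 K.+1 (leqW le_Kn)).
rewrite -le_coef; have [[s s01 ->]|[s s01 ->]] := unit_split q01 t01.
  exact: (near_graph_left (ltnW le_Kn) fk fl le_inv bl nl s01).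
exact: (near_graph_right (k := K.+1) le_Kn fk fr le_inv br nr s01).
Unshelve. all: by end_near. Qed.

Lemma near_graph_le n m d d' : d <= d' -> near_graph n m d -> near_graph n m d'.
Proof.
by move=> le_dd nd t /nd[t' t'01 le_d]; exists t' => //; exact: le_trans le_dd.
Qed.

Lemma eventually_near_all d : 0 < d -> eventually_near d.
Proof.
move=> d_gt0.
pose d0 := vscale * (curve_bound + (1 - contraction p)^-1).
have d0_gt0 : 0 < d0.
  by rewrite mulr_gt0 // addr_gt0 // invr_gt0 subr_gt0.
have factor_gt0 : 0 < factor by rewrite addr_gt0 // mulr_gt0.
have iter_near j : eventually_near (factor ^+ j * d0).
  elim: j => [|j IHj]; first by rewrite mul1r; exact: eventually_near_init.
  rewrite exprS -mulrA; apply: eventually_near_step => //.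
  by rewrite mulr_gt0 ?exprn_gt0.
have /cvgrPdist_le/(_ (d / d0) (divr_gt0 d_gt0 d0_gt0)) :
    factor ^+ j @[j --> \oo] --> (0 : R).
  by apply: cvg_expr; rewrite gtr0_norm.
case=> j _ /(_ j (leqnn j)) /=.
rewrite sub0r normrN normrX gtr0_norm // ler_pdivlMr // => le_d k k_adm.
by apply: filterS (iter_near j k k_adm) => n; exact: near_graph_le.
Qed.

Lemma renorm_curve_cvg k (e : R) : admissible k -> 0 < e ->
  \forall n \near \oo, forall t, 0 <= t <= 1 ->
    `|renorm_curve n (k n) t - limit_curve p t| <= e.
Proof.
move=> k_adm e_gt0; have e2_gt0 : 0 < e / 2 by rewrite divr_gt0.
have [d d_gt0 unif] := limit_curve_unif p01 e2_gt0.
have m_gt0 : 0 < Num.min d (vscale * (e / 2)) by rewrite lt_min d_gt0 mulr_gt0.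
apply: filterS (eventually_near_all m_gt0 k_adm) => n near_n t t01.
have [t' t'01 le_m] := near_n t t01.
have v_ge0 : 0 <= vscale * `|renorm_curve n (k n) t - limit_curve p t'|.
  by rewrite mulr_ge0 // ltW.
have le_d : `|t' - t| <= d.
  rewrite distrC (@le_trans _ _ (Num.min d (vscale * (e / 2)))) //;
    last by rewrite ge_min lexx.
  by apply: le_trans le_m; rewrite lerDl.
have le_e : `|renorm_curve n (k n) t - limit_curve p t'| <= e / 2.
  rewrite -(ler_pM2l c_gt0) (@le_trans _ _ (Num.min d (vscale * (e / 2)))) //.
    by apply: le_trans le_m; rewrite lerDr.
  by rewrite ge_min lexx orbT.
rewrite [leRHS](splitr e) -(subrKA (limit_curve p t')).
by rewrite (le_trans (ler_normD _ _)) // lerD // unif.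
Qed.

End Convergence.

(** * The essential supremum and the theorem *)

Lemma Linfty_norm01_le (R : realType) (f : R -> R) (e : R) :
  0 <= e -> (forall t, 0 <= t <= 1 -> `|f t| <= e) ->
  (Linfty_norm01 f <= e%:E)%E.
Proof.
move=> e_ge0 le_e; rewrite /Linfty_norm01 unlock /Lnorm.
case: ifP => _; last by rewrite lee_fin.
apply/ess_supP; exists (~` `[0, 1]); split.
- by apply: measurableC; exact: measurable_itv.
- by rewrite /= /mrestr setICl measure0.
move=> t /=; apply: contra_not => t01; rewrite lee_fin; apply: le_e.
by move: t01; rewrite in_itv.
Qed.

Lemma of_order_cvg (R : realType) (u v r : nat -> R) (l : R) : 0 < l ->
  (\forall n \near \oo, 0 <= v n) -> (\forall n \near \oo, u n = r n * v n) ->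
  r n @[n --> \oo] --> l -> of_order u v.
Proof.
move=> l_gt0 v_ge0 uE r_cvg; exists (l / 2), (2 * l); split; [lra | lra |].
near=> n; have v_n : 0 <= v n by near: n.
have uE_n : u n = r n * v n by near: n.
have /ler_normlP[r1 r2] : `|l - r n| <= l / 2.
  by near: n; move/cvgrPdist_le: r_cvg; apply; rewrite divr_gt0.
rewrite uE_n normrM (ger0_norm v_n) ger0_norm; last lra.
by split; rewrite ler_wpM2r //; lra.
Unshelve. all: by end_near. Qed.

Lemma renorm_order (R : realType) (p : R) (k : nat -> nat) :
  0 < p < 1 -> admissible p k ->
  of_order (fun n => renorm R n (k n)) (fun n => ('C(n, k n))%:R / n%:R).
Proof.
move=> p01 k_adm; have [k_le k_cvg] := k_adm; have /andP[p_gt0 p_lt1] := p01.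
pose r n : R :=
  2 * ((k n)%:R / n%:R) * (1 - (k n)%:R / n%:R) * (1 + n.-1%:R^-1).
apply: (@of_order_cvg _ _ _ r (2 * p * (1 - p) * (1 + 0))).
- by rewrite addr0 mulr1 !mulr_gt0 // subr_gt0.
- by apply: nearW => n; rewrite divr_ge0.
- apply: filterS (admissible_margin p01 k_adm) => n [_ _ k1 k2].
  rewrite /r; case: n (k n) k1 k2 => [|[|n]] [|j] //= _; rewrite !ltnS => lejn.
  rewrite renormE 1?ltnW // -!natr1; field.
  by rewrite !gt_eqF //; have := ler0n R n; lra.
apply: cvgM; last first.
  apply: cvgD; first exact: cvg_cst.
  rewrite -(cvg_shiftS (fun n : nat => n.-1%:R^-1 : R)) /=.
  by rewrite -(cvg_shiftS (fun n : nat => n%:R^-1 : R)); exact: cvg_harmonic.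
apply: cvgM; first by apply: cvgM; [exact: cvg_cst|].
by apply: cvgB; [exact: cvg_cst|].
Qed.

Theorem theorem2p1 (R : realType) (p : R) (k : nat -> nat)
    (p_gt0 : 0 < p) (p_lt1 : p < 1)
    (k_le : forall n : nat, (k n <= n)%N)
    (k_cvg : (k n)%:R / n%:R @[n --> \oo] --> p) :
  (Linfty_norm01 (fun t => renorm_curve n (k n) t - blancmange p t)
     @[n --> \oo] --> 0%E)
  /\ of_order (fun n => renorm R n (k n)) (fun n => ('C(n, k n))%:R / n%:R).
Proof.
have p01 : 0 < p < 1 by rewrite p_gt0.
have k_adm : admissible p k by [].
split; last exact: renorm_order p01 k_adm.
pose u n := Linfty_norm01 (fun t => renorm_curve n (k n) t - blancmange p t).
have norm_le (e : R) : 0 < e -> \forall n \near \oo, (0 <= u n <= e%:E)%E.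
  move=> e_gt0; apply: filterS (renorm_curve_cvg p01 k_adm e_gt0) => n le_e.
  rewrite Lnorm_ge0 Linfty_norm01_le ?ltW // => t t01.
  by rewrite blancmangeE // le_e.
apply/fine_cvgP; split.
  apply: filterS (norm_le 1 ltr01) => n /andP[ge0 le1].
  by rewrite ge0_fin_numE // (le_lt_trans le1) ?ltry.
apply/cvgrPdist_le => e e_gt0.
apply: filterS (norm_le e e_gt0) => n /andP[ge0 le_e].
rewrite sub0r normrN /= ger0_norm ?fine_ge0 // -lee_fin fineK //.
by rewrite ge0_fin_numE // (le_lt_trans le_e) ?ltry.
Qed.
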